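(* Consider a run of the trust-region algorithm described in the context, with its stopping test ignored, and with $\nu_k=\alpha\Delta_k/(1+\|B_k\|(1+\alpha\Delta_k))$ at every iteration. Assume that: (i) there is $\kappa_{\mathrm{mdc}}\in(0,1)$ such that $m(0;x_k,B_k)-m(s_k;x_k,B_k)\ge\kappa_{\mathrm{mdc}}\,\xi_{\mathrm{cp}}(\Delta_k;x_k,\nu_k)$ for all $k$; (ii) there is $\kappa_{\mathrm{ubd}}>0$ such that $|(f+h)(x_k+s_k)-m(s_k;x_k,B_k)|\le\kappa_{\mathrm{ubd}}(1+\|B_k\|)\|s_k\|^2$ for all $k$; (iii) there are $\mu>0$ and $0<p<1$ such that $\max_{0\le j\le k}\|B_j\|\le\mu(1+\sigma_k^p)$ for all $k\in\mathbb N$; (iv) infinitely many iterations are successful, and $\mu+1\le\mu|S(\epsilon)|^p$ for all sufficiently small $\epsilon\in(0,1)$; (v) $(f+h)(x_k)$ is bounded below over $k\in\mathbb N$. Let $N\subseteq\mathbb N$ be an infinite index set such that $\{\nu_k^{-1/2}\xi_{\mathrm{cp}}(\Delta_k;x_k,\nu_k)^{1/2}\}_{k\in N}\to0$, $\{\nu_k^{-1}s_{k,1}\}_{k\in N}\to0$, $\{s_{k,1}\}_{k\in N}\to0$ and $\{s_k\}_{k\in N}\to0$. Let $N_1\subseteq N$ be infinite with $\{\nu_k\}_{k\in N_1}\to\bar\nu>0$, and let $\{x_k\}_{k\in N_1}\to\bar x\in[\ell,u]$. Assume that there is $\overline\psi:\mathbb R^n\to\overline{\mathbb R}$ such that $\{\psi(\cdot;x_k)\}_{k\in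 N_1}\to\overline\psi$ continuously, with $\overline\psi$ proper lsc, $\overline\psi(0)=h(\bar x)$ and $\partial\overline\psi(0)\subseteq\partial h(\bar x)$. Assume further that the constraint qualification is satisfied at $s=0$ for $$\min_s\ \overline m_{\mathrm{cp}}(s;\bar x,\bar\nu)+\chi(\bar x+s\mid[\ell,u]),\qquad\overline m_{\mathrm{cp}}(s;\bar x,\bar\nu):=\varphi_{\mathrm{cp}}(s;\bar x)+\tfrac12\bar\nu^{-1}\|s\|^2+\overline\psi(s),$$ and that it is satisfied at $\bar x$ for the problem (P) of minimizing $f+h$ over $[\ell,u]$. If $-\infty<\inf_s\,\overline m_{\mathrm{cp}}(s;\bar x,\bar\nu)+\chi(\bar x+s\mid[\ell,u])<\infty$, then $\bar x$ is stationary for (P).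
   Context: Norms and notation: $\|\cdot\|$ is the Euclidean norm on $\mathbb R^n$ and the induced spectral norm on matrices; $\mathbb B$ is the closed Euclidean unit ball; $\overline{\mathbb R}=\mathbb R\cup\{\pm\infty\}$; $\chi(x\mid A)=0$ if $x\in A$ and $+\infty$ otherwise. Problem (P): minimize $f(x)+h(x)$ over $x\in\mathbb R^n$ subject to $\ell\le x\le u$, where $\ell\in(\mathbb R\cup\{-\infty\})^n$, $u\in(\mathbb R\cup\{+\infty\})^n$, $\ell\le u$, $f:\mathbb R^n\to\mathbb R$ is continuously differentiable on an open set containing $[\ell,u]$, and $h:\mathbb R^n\to\mathbb R\cup\{+\infty\}$ is proper and lower semicontinuous (lsc). Both may be nonconvex. Subdifferentials: for $\phi:\mathbb R^n\to\overline{\mathbb R}$ finite at $\bar x$, $\widehat\partial\phi(\bar x)$ is the set of $v$ with $\liminf_{x\to\bar x,x\ne\bar x}\frac{\phi(x)-\phi(\bar x)-v^T(x-\bar x)}{\|x-\bar x\|}\ge0$; $\partial\phi(\bar x)$ is the set of $v$ for which there are $x_k\to\bar x$, $v_k\to v$ with $\phi(x_k)\to\phi(\bar x)$ and $v_k\in\widehat\partial\phi(x_k)$; $\partial^\infty\phi(\bar x)$ is the set of $v$ for which there are $x_k\to\bar x$, $\lambda_k\downarrow0$ and $v_k\in\widehat\partial\phi(x_k)$ with $\phi(x_k)\to\phi(\bar x)$ and $\lambda_kv_k\to v$. The normal cone is $N_C(\bar x)=\partial\chi(\cdot\mid C)(\bar x)$. The constraint qualification (CQ) holds at $\bar x\in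 C$ for minimizing $\phi$ over closed $C$ if $\partial^\infty\phi(\bar x)\cap(-N_C(\bar x))=\{0\}$ (for (P): $\phi=f+h$, $C=[\ell,u]$; for a problem with term $\chi(\bar x+s\mid[\ell,u])$: $C=\{s\mid\bar x+s\in[\ell,u]\}$). $\bar x$ is (first-order) stationary for (P) if $0\in\nabla f(\bar x)+\partial h(\bar x)+N_{[\ell,u]}(\bar x)$. Continuous convergence: $\{\phi_k\}\to\phi$ continuously if $\phi_k(y_k)\to\phi(y)$ for every sequence $y_k\to y$ in $\mathbb R^n$. Models: for every $x$ where $h$ is finite, a model $\psi(\cdot;x):\mathbb R^n\to\overline{\mathbb R}$ of $s\mapsto h(x+s)$ is given; it is assumed proper lsc with $\psi(0;x)=h(x)$ and $\partial\psi(0;x)\subseteq\partial h(x)$. Set $\varphi_{\mathrm{cp}}(s;x)=f(x)+\nabla f(x)^Ts$, $m_{\mathrm{cp}}(s;x,\nu)=\varphi_{\mathrm{cp}}(s;x)+\tfrac12\nu^{-1}\|s\|^2+\psi(s;x)$, and $m(s;x,B)=f(x)+\nabla f(x)^Ts+\tfrac12s^TBs+\psi(s;x)$ with $B=B^T$. Algorithm: constants $0<\eta_1\le\eta_2<1$, $0<1/\gamma_3\le\gamma_1\le\gamma_2<1<\gamma_3\le\gamma_4$, $\Delta_{\max}>\Delta_0>0$, $\alpha>0$, $\beta\ge1$, tolerance $\epsilon>0$, and $x_0\in[\ell,u]$ with $h(x_0)$ finite. At iteration $k=0,1,\dots$, with a symmetric matrix $B_k$: (1) choose $0<\nu_k\le\frac{\alpha\Delta_k}{1+\|B_k\|(1+\alpha\Delta_k)}$;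 (2) compute $s_{k,1}\in\operatorname{argmin}_s\,m_{\mathrm{cp}}(s;x_k,\nu_k)+\chi(x_k+s\mid[\ell,u]\cap(x_k+\Delta_k\mathbb B))$ and let $\xi_{\mathrm{cp}}(\Delta_k;x_k,\nu_k)=f(x_k)+h(x_k)-\varphi_{\mathrm{cp}}(s_{k,1};x_k)-\psi(s_{k,1};x_k)$; (3) stopping test: terminate if $\nu_k^{-1/2}\xi_{\mathrm{cp}}(\Delta_k;x_k,\nu_k)^{1/2}\le\epsilon$; (4) compute an approximate minimizer $s_k$ of $m(\cdot;x_k,B_k)$ subject to $x_k+s\in[\ell,u]$, $\|s\|\le\min(\Delta_k,\beta\|s_{k,1}\|)$, meaning a feasible $s_k$ with $m(s_k;x_k,B_k)\le m(s_{k,1};x_k,B_k)$; (5) compute $\rho_k=\frac{(f+h)(x_k)-(f+h)(x_k+s_k)}{m(0;x_k,B_k)-m(s_k;x_k,B_k)}$; set $x_{k+1}=x_k+s_k$ if $\rho_k\ge\eta_1$ and $x_{k+1}=x_k$ otherwise; (6) choose $\bar\Delta_{k+1}\in[\gamma_3\Delta_k,\gamma_4\Delta_k]$ if $\rho_k\ge\eta_2$ (very successful), in $[\gamma_2\Delta_k,\Delta_k]$ if $\eta_1\le\rho_k<\eta_2$, in $[\gamma_1\Delta_k,\gamma_2\Delta_k]$ if $\rho_k<\eta_1$ (unsuccessful); set $\Delta_{k+1}=\min(\bar\Delta_{k+1},\Delta_{\max})$. Iteration $k$ is successful if $\rho_k\ge\eta_1$. $\sigma_k=|\{j=0,\dots,k\mid\rho_j\ge\eta_1\}|$.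 For $0<\epsilon<1$, $k_\epsilon$ is the first iteration with $\nu_k^{-1/2}\xi_{\mathrm{cp}}(\Delta_k;x_k,\nu_k)^{1/2}\le\epsilon$ ($k_\epsilon=\infty$ if there is none), and $S(\epsilon)=\{k=0,\dots,k_\epsilon-1\mid\rho_k\ge\eta_1\}$. *)

(* Defs.v *)
From HB Require Import structures.
From mathcomp Require Import all_boot all_order all_algebra.
From mathcomp Require Import all_classical all_reals all_analysis.
Export numFieldNormedType.Exports.

Set Implicit Arguments.
Unset Strict Implicit.
Unset Printing Implicit Defensive.

Import Order.TTheory GRing.Theory Num.Theory.

Local Open Scope classical_set_scope.
Local Open Scope ring_scope.

(* Vectors of R^n are rows.  The topology of 'rV[R]_n is the usual one, but the
   library norm `|v| on it is the sup norm; enorm is the Euclidean norm. *)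
Section Euclidean.
Context {R : realType} {n : nat}.
Implicit Types (u v x : 'rV[R]_n) (B : 'M[R]_n).

Definition dot u v : R := \sum_(i < n) u 0 i * v 0 i.
Definition enorm v : R := Num.sqrt (dot v v).

(* As vectors are rows, v *m B^T is the product of B and v. *)
Definition spectral_norm B : R :=
  sup [set enorm (v *m B^T) | v in [set v | enorm v <= 1]].

Definition quad B v : R := dot v (v *m B^T).

Definition eball x (r : R) : set 'rV[R]_n := [set y | enorm (y - x) <= r].

Definition box (l u : 'rV[\bar R]_n) : set 'rV[R]_n :=
  [set x | forall i, (l 0%R i <= (x 0%R i)%:E <= u 0%R i)%E].

Definition grad (f : 'rV[R]_n -> R) x : 'rV[R]_n :=
  \row_i 'D_(delta_mx 0 i) f x.

Definition continuously_differentiable_on (f : 'rV[R]_n -> R)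
    (O : set 'rV[R]_n) : Prop :=
  forall x, O x -> differentiable f x /\ {for x, continuous (grad f)}.

End Euclidean.

Section Variational.
Context {R : realType} {n : nat}.
Implicit Types (phi : 'rV[R]_n -> \bar R) (x v : 'rV[R]_n) (C : set 'rV[R]_n).
Local Open Scope ereal_scope.

Definition proper_function phi : Prop :=
  (forall x, phi x != -oo) /\ exists x, phi x != +oo.

Definition chi C x : \bar R := if x \in C then 0 else +oo.

(* All three subdifferentials are empty where phi is not finite. *)
Definition frechet_subdiff phi x : set 'rV[R]_n :=
  [set v | phi x \is a fin_num /\
    0 <= limf_einf (fun y : 'rV[R]_n =>
           (phi y - phi x - (dot v (y - x))%:E) / (enorm (y - x))%:E) x^'].

Definition subdiff phi x : set 'rV[R]_n :=
  [set v | phi x \is a fin_num /\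
    exists xs vs : nat -> 'rV[R]_n,
      [/\ xs @ \oo --> x, vs @ \oo --> v, phi (xs k) @[k --> \oo] --> phi x
        & forall k, frechet_subdiff phi (xs k) (vs k)]].

Definition horizon_subdiff phi x : set 'rV[R]_n :=
  [set v | phi x \is a fin_num /\
    exists (xs vs : nat -> 'rV[R]_n) (lam : nat -> R),
      [/\ xs @ \oo --> x,
          (forall k, 0 < lam k)%R /\ lam @ \oo --> 0%R,
          phi (xs k) @[k --> \oo] --> phi x,
          forall k, frechet_subdiff phi (xs k) (vs k)
        & (lam k *: vs k)%R @[k --> \oo] --> v]].

Definition normal_cone C x : set 'rV[R]_n := subdiff (chi C) x.

Definition constraint_qualification phi C x : Prop :=
  horizon_subdiff phi x `&` [set (- v)%R | v in normal_cone C x] = [set 0%R].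

Definition argmin phi : set 'rV[R]_n := [set s | forall t, phi s <= phi t].

Definition objective (f : 'rV[R]_n -> R) (h : 'rV[R]_n -> \bar R) x : \bar R :=
  (f x)%:E + h x.

Definition stationary (f : 'rV[R]_n -> R) (h : 'rV[R]_n -> \bar R)
    (l u : 'rV[\bar R]_n) x : Prop :=
  exists v w : 'rV[R]_n,
    [/\ subdiff h x v, normal_cone (box l u) x w & (grad f x + v + w = 0)%R].

(* Only the values of ys on the index set N matter. *)
Definition continuous_cvg_along (N : set nat)
    (phis : nat -> 'rV[R]_n -> \bar R) (phi : 'rV[R]_n -> \bar R) : Prop :=
  forall (ys : nat -> 'rV[R]_n) (y : 'rV[R]_n),
    ys @ within N \oo --> y ->
    phis k (ys k) @[k --> within N \oo] --> phi y.

End Variational.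

Section Models.
Context {R : realType} {n : nat}.
Variable f : 'rV[R]_n -> R.
Implicit Types (x s : 'rV[R]_n) (ps : 'rV[R]_n -> \bar R).

Definition phi_cp x s : R := f x + dot (grad f x) s.

(* ps stands for psi(.; x), or for its limit. *)
Definition m_cp ps x (nu : R) s : \bar R :=
  ((phi_cp x s + 2^-1 * nu^-1 * enorm s ^+ 2)%:E + ps s)%E.

Definition m_quad ps x (B : 'M[R]_n) s : \bar R :=
  ((phi_cp x s + 2^-1 * quad B s)%:E + ps s)%E.

End Models.

(* psi x is the model psi(.; x) of s |-> h (x + s). *)
Definition model_assumption (R : realType) (n : nat)
    (h : 'rV[R]_n -> \bar R) (psi : 'rV[R]_n -> 'rV[R]_n -> \bar R) : Prop :=
  forall x, h x \is a fin_num ->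
    [/\ proper_function (psi x), lower_semicontinuous (psi x), psi x 0 = h x
      & subdiff (psi x) 0 `<=` subdiff h x].

Record tr_constants (R : realType) := TRConstants {
  eta1 : R; eta2 : R;
  gamma1 : R; gamma2 : R; gamma3 : R; gamma4 : R;
  Delta_max : R; Delta0 : R;
  alpha : R; beta : R;
  eta_bounds : 0 < eta1 <= eta2 /\ eta2 < 1;
  gamma_bounds : [/\ 0 < gamma3^-1 <= gamma1, gamma1 <= gamma2 < 1
                   & 1 < gamma3 <= gamma4];
  Delta_bounds : 0 < Delta0 < Delta_max;
  alpha_gt0 : 0 < alpha;
  beta_ge1 : 1 <= beta
}.

Record tr_sequences (R : realType) (n : nat) := TRSequences {
  iter_x : nat -> 'rV[R]_n;
  iter_s1 : nat -> 'rV[R]_n;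
  iter_s : nat -> 'rV[R]_n;
  iter_B : nat -> 'M[R]_n;
  iter_nu : nat -> R;
  iter_Delta : nat -> R
}.

Section TrustRegion.
Context {R : realType} {n : nat}.
Variables (f : 'rV[R]_n -> R) (h : 'rV[R]_n -> \bar R).
Variables (l u : 'rV[\bar R]_n) (psi : 'rV[R]_n -> 'rV[R]_n -> \bar R).
Variables (c : tr_constants R) (it : tr_sequences R n).

Local Notation x := (iter_x it).
Local Notation s1 := (iter_s1 it).
Local Notation s := (iter_s it).
Local Notation B := (iter_B it).
Local Notation nu := (iter_nu it).
Local Notation Delta := (iter_Delta it).

Definition nu_max (k : nat) : R :=
  alpha c * Delta k / (1 + spectral_norm (B k) * (1 + alpha c * Delta k)).

Definition m_k (k : nat) (t : 'rV[R]_n) : \bar R :=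
  m_quad f (psi (x k)) (x k) (B k) t.

Definition xi_cp (k : nat) : \bar R :=
  (objective f h (x k) - (phi_cp f (x k) (s1 k))%:E - psi (x k) (s1 k))%E.

(* xi_cp k is finite and nonnegative along a run. *)
Definition criticality (k : nat) : R :=
  Num.sqrt (nu k)^-1 * Num.sqrt (fine (xi_cp k)).

(* The quotient is taken in \bar R as h may be +oo at the trial point.  The
   denominator can only vanish past the stopping test; there, with 0^-1 = +oo,
   the ratio is 0 or infinite according to the sign of the numerator. *)
Definition rho (k : nat) : \bar R :=
  ((objective f h (x k) - objective f h (x k + s k)%R)
     / (m_k k 0%R - m_k k (s k)))%E.

Definition successful (k : nat) : bool := ((eta1 c)%:E <= rho k)%E.
Definition very_successful (k : nat) : bool := ((eta2 c)%:E <= rho k)%E.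

Definition sigma (k : nat) : nat := #|[pred j : 'I_k.+1 | successful j]|.

(* None stands for k_eps = +oo. *)
Definition k_eps (eps : R) : option nat :=
  if pselect (exists k, criticality k <= eps) is left ex
  then Some (ex_minn ex) else None.

Definition S_eps (eps : R) : set nat :=
  [set k | (if k_eps eps is Some K then (k < K)%N else true) /\ successful k].

Definition radius_range (k : nat) (D : R) : Prop :=
  if very_successful k then gamma3 c * Delta k <= D <= gamma4 c * Delta k
  else if successful k then gamma2 c * Delta k <= D <= Delta k
  else gamma1 c * Delta k <= D <= gamma2 c * Delta k.

(* An infinite run: the stopping test is never applied. *)
Record tr_run : Prop := {
  run_x0 : box l u (x 0%N) /\ h (x 0%N) \is a fin_num;
  run_Delta0 : Delta 0%N = Delta0 c;
  run_B : forall k, (B k)^T = B k;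
  run_nu : forall k, 0 < nu k <= nu_max k;
  run_s1 : forall k, argmin (fun t =>
    (m_cp f (psi (x k)) (x k) (nu k) t +
     chi (box l u `&` eball (x k) (Delta k)) (x k + t)%R)%E) (s1 k);
  run_s : forall k, [/\ box l u (x k + s k),
    enorm (s k) <= Num.min (Delta k) (beta c * enorm (s1 k))
    & (m_k k (s k) <= m_k k (s1 k))%E];
  run_x : forall k, x k.+1 = if successful k then x k + s k else x k;
  run_Delta : forall k, exists2 D, radius_range k D
    & Delta k.+1 = Num.min D (Delta_max c)
}.

End TrustRegion.

(* Main.v *)
(** Since nu_k -> nubar > 0, the radii Delta_k stay bounded away from 0, and a
    shifted point xbar + s - x_k is eventually feasible for the k-th Cauchy
    subproblem as soon as xbar + s lies in the box and s is small.  Comparing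
    s_(k,1) with it and letting k tend to infinity shows that 0 is a local
    minimizer of the limit model over the box.  The limiting Fermat rule under
    the constraint qualification, proved by quadratic penalization of the
    constraint y = z for g(y) + chi(z), then splits 0 into a subgradient of the
    limit model and a normal vector. *)

Require Import Defs.
From mathcomp Require Import all_boot all_order all_algebra.
From mathcomp Require Import all_classical all_reals all_analysis.

From mathcomp Require Import ring lra.

Import Order.TTheory GRing.Theory Num.Theory.

Local Open Scope classical_set_scope.
Local Open Scope ring_scope.

(** * Algebra and continuity of the Euclidean inner product *)

Section Dot.
Context {R : realType} {n : nat}.
Implicit Types (u v w x y z : 'rV[R]_n) (a : R).

Lemma dotC u v : dot u v = dot v u.
Proof. by apply: eq_bigr => i _; rewrite mulrC. Qed.

Lemma dotDl u v w : dot (u + v) w = dot u w + dot v w.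
Proof. by rewrite -big_split; apply: eq_bigr => i _; rewrite mxE mulrDl. Qed.

Lemma dotZl a u v : dot (a *: u) v = a * dot u v.
Proof. by rewrite mulr_sumr; apply: eq_bigr => i _; rewrite mxE mulrA. Qed.

Lemma dotNl u v : dot (- u) v = - dot u v.
Proof. by rewrite -scaleN1r dotZl mulN1r. Qed.

Lemma dotDr u v w : dot u (v + w) = dot u v + dot u w.
Proof. by rewrite dotC dotDl ![dot _ u]dotC. Qed.

Lemma dotZr a u v : dot u (a *: v) = a * dot u v.
Proof. by rewrite dotC dotZl dotC. Qed.

Lemma dotNr u v : dot u (- v) = - dot u v.
Proof. by rewrite dotC dotNl dotC. Qed.

Lemma dot0l v : dot 0 v = 0.
Proof. by rewrite -(scale0r v) dotZl mul0r. Qed.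

Lemma dotvv_ge0 v : 0 <= dot v v.
Proof. by apply: sumr_ge0 => i _; rewrite -expr2 sqr_ge0. Qed.

Lemma dotvv_eq0 v : (dot v v == 0) = (v == 0).
Proof.
apply/eqP/eqP => [|->]; last exact: dot0l.
move/psumr_eq0P => h; apply/rowP => i; rewrite mxE; apply/eqP.
by rewrite -(sqrf_eq0 (v 0 i)) expr2 h// => j _; rewrite -expr2 sqr_ge0.
Qed.

Lemma sqr_enorm v : enorm v ^+ 2 = dot v v.
Proof. by rewrite sqr_sqrtr// dotvv_ge0. Qed.

Lemma enorm_ge0 v : 0 <= enorm v.
Proof. exact: sqrtr_ge0. Qed.

Lemma enorm0 : enorm (0 : 'rV[R]_n) = 0.
Proof. by rewrite /enorm dot0l sqrtr0. Qed.

Lemma enorm_gt0 v : (0 < enorm v) = (v != 0).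
Proof. by rewrite sqrtr_gt0 lt0r dotvv_ge0 dotvv_eq0 andbT. Qed.

Lemma cvg_dot {T : Type} {F : set_system T} {FF : Filter F}
    (f g : T -> 'rV[R]_n) u v :
  f @ F --> u -> g @ F --> v -> dot (f t) (g t) @[t --> F] --> dot u v.
Proof.
move=> fu gv.
have cc (h : T -> 'rV[R]_n) w i : h @ F --> w -> h t 0 i @[t --> F] --> w 0 i.
  move=> hw; apply: (@continuous_cvg _ _ _ F _ _ (fun v : 'rV[R]_n => v 0 i)).
  - exact: coord_continuous.
  - exact: hw.
apply: (@cvg_big _ _ _ _ _ _ _ _ _ (fun i t => f t 0 i * g t 0 i)).
  exact: add_continuous.
by move=> i _; apply: cvgM; apply: cc.
Qed.

Lemma cvg_enorm {T : Type} {F : set_system T} {FF : Filter F}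
    (f : T -> 'rV[R]_n) u :
  f @ F --> u -> enorm (f t) @[t --> F] --> enorm u.
Proof.
move=> fu; apply: (@continuous_cvg _ _ _ F _ (fun t => dot (f t) (f t)) Num.sqrt).
  exact: sqrt_continuous.
exact: cvg_dot.
Qed.

Lemma cvg_sqdist {T : Type} {F : set_system T} {FF : Filter F}
    (f g : T -> 'rV[R]_n) u v : f @ F --> u -> g @ F --> v ->
  dot (f t - g t) (f t - g t) @[t --> F] --> dot (u - v) (u - v).
Proof. by move=> fu gv; apply: cvg_dot; apply: (@cvgB R 'rV[R]_n). Qed.

Lemma dot_sqrD u v : dot (u + v) (u + v) = dot u u + 2 * dot u v + dot v v.
Proof. by rewrite dotDl !dotDr (dotC v u); ring. Qed.

End Dot.

(** * Compactness, extraction of limits, lower semicontinuity *)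

Section Compactness.
Context {R : realType}.

(** The sublevel sets traced on [K] form a filter base, and each of its cluster points in [K] is a
    minimizer: if its value exceeded [phi y], lower semicontinuity would give a neighbourhood
    missing the sublevel set of [y]. *)
Lemma compact_lsc_min {X : topologicalType} (K : set X) (phi : X -> \bar R) :
  compact K -> K !=set0 -> lower_semicontinuous phi ->
  exists2 x, K x & forall y, K y -> (phi x <= phi y)%E.
Proof.
move=> cK [x0 Kx0] lsc.
pose B y := K `&` [set z | (phi z <= phi y)%E].
have PF : ProperFilter (filter_from K B).
  apply: filter_from_proper => [|y Ky]; last by exists y; split=> /=.
  apply: filter_from_filter; first by exists x0.
  move=> i j Ki Kj; case: (leP (phi i) (phi j)) => ij.
    by exists i => // z [Kz zi]; split; split=> //=; exact: le_trans ij.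
  by exists j => // z [Kz zi]; split; split=> //=; exact: le_trans (ltW ij).
have [x [Kx clx]] := cK _ PF (ex_intro2 _ _ x0 Kx0 (@subIsetl _ K _)).
exists x => // y Ky; rewrite leNgt; apply/negP => yx.
(* Lower semicontinuity is tested against real levels, so a real [a] is inserted even when one of
   the two values is infinite. *)
have [a ya ax] : exists2 a : R, (phi y <= a%:E)%E & (a%:E < phi x)%E.
  move: yx; case: (phi y) => [r||]; first by exists r.
    by rewrite ltNge leey.
  case: (phi x) => [r||] //.
  - by move=> _; exists (r - 1); rewrite ?leNye// lte_fin; lra.
  - by move=> _; exists 0; rewrite ?leNye// ltry.
have [V Vx Va] := lsc _ _ ax.
have [z [[_ /= zy] Vz]] := clx (B y) V (ex_intro2 _ _ y Ky (@subset_refl _ _)) Vx.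
by have := le_lt_trans (le_trans zy ya) (Va _ Vz); rewrite ltxx.
Qed.

Lemma cvg_ge_id (sg : nat -> nat) :
  (forall k, (k <= sg k)%N) -> sg @ \oo --> \oo.
Proof.
move=> h; apply/cvgnyPge => A; exists A => // k /= Ak; exact: leq_trans (h k).
Qed.

(** The extraction [sg] may fail to be increasing, but [k <= sg k] makes it tend to infinity, which
    suffices to carry limits over. *)
Lemma compact_extraction {X : pseudoMetricType R} (K : set X) (a : nat -> X) :
  compact K -> (forall k, K (a k)) ->
  exists2 x, K x & exists2 sg : nat -> nat,
    (forall k, (k <= sg k)%N) & a \o sg @ \oo --> x.
Proof.
move=> cK Ka.
have [|x [Kx clx]] := cK (a @ \oo) _; first by exists 0%N => // k _; exact: Ka.
exists x => //.
have /choice [sg sgP] : forall k : nat, exists m, (k <= m)%N /\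
    ball x k.+1%:R^-1 (a m).
  move=> k; have [||z [[m /= km <-] bz]] := clx [set a m | m in [set m | (k <= m)%N]]
    (ball x k.+1%:R^-1); last by exists m.
  - by exists k => // m /= km; exists m.
  - by apply: nbhsx_ballx; rewrite invr_gt0.
exists sg => [k|]; first by have [] := sgP k.
apply/cvg_ballP => e e0; near=> k.
apply: (@le_ball _ _ _ k.+1%:R^-1); last by have [] := sgP k.
by apply/ltW; near: k; exact: (near_infty_natSinv_lt (PosNum e0)).
Unshelve. all: end_near. Qed.

Lemma compact_closed_ball {n : nat} (x : 'rV[R]_n) (e : R) :
  compact [set y : 'rV[R]_n | `|y - x| <= e].
Proof.
apply: bounded_closed_compact.
  exists (`|x| + e); split; first exact: num_real.
  move=> r er y /= ye; rewrite -(subrK x y).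
  by apply: le_trans (ler_normD _ _) _; lra.
apply: (@preimage_closed _ R (fun y : 'rV[R]_n => `|y - x|) [set r | r <= e]);
  last exact: closed_le.
move=> y _; apply: (@cvg_norm R 'rV[R]_n _ (nbhs y) _ (fun y : 'rV[R]_n => y - x)).
exact: (@cvgB R 'rV[R]_n _ (nbhs y) _ id (fun=> x) y x cvg_id (cvg_cst _)).
Qed.

Lemma lsc_addr {X : topologicalType} (q : X -> R) (phi : X -> \bar R) :
  continuous q -> lower_semicontinuous phi ->
  lower_semicontinuous (fun x => (q x)%:E + phi x)%E.
Proof.
move=> cq lsc x a aqphi.
have near_q (e : R) : 0 < e -> \forall y \near x, q x - e < q y.
  move=> e0; have /cvgrPdist_lt/(_ e e0) := cq x.
  by apply: filterS => y; rewrite ltr_distlC => /andP[].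
have near_phi b : (b%:E < phi x)%E -> \forall y \near x, (b%:E < phi y)%E.
  by move=> /lsc[V Vx Vb]; apply: filterS Vx.
(* Half of the gap between [a] and [q x + phi x] is granted to the variation of [q]; when [phi x] is
   infinite any [e] will do. *)
suff [e e0 b] : exists2 e : R, 0 < e & ((a - q x + e)%:E < phi x)%E.
  exists [set y | q x - e < q y /\ ((a - q x + e)%:E < phi y)%E].
    by apply: filterI; [exact: near_q|exact: near_phi b].
  move=> y /= []; case: (phi y) => [s||]//; last by rewrite addey ?ltry.
  by rewrite -EFinD !lte_fin; lra.
move: aqphi; case: (phi x) => [r||] //.
  rewrite -EFinD lte_fin => arx; exists ((q x + r - a) / 2); first by lra.
  by rewrite lte_fin; lra.
by move=> _; exists 1 => //; rewrite ltry.
Qed.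

Lemma lsc_comp {X Y : topologicalType} (q : X -> Y) (phi : Y -> \bar R) :
  continuous q -> lower_semicontinuous phi -> lower_semicontinuous (phi \o q).
Proof.
move=> cq lsc x a /lsc[V Vx Va]; exists (q @^-1` V); first exact: cq.
by move=> y /= /Va.
Qed.

End Compactness.

(** * Calculus of Frechet subgradients and indicators *)

Section Subdifferentials.
Context {R : realType} {n : nat}.
Implicit Types (phi : 'rV[R]_n -> \bar R) (q : 'rV[R]_n -> R).
Implicit Types (x y z v w : 'rV[R]_n) (C : set 'rV[R]_n).

Lemma difference_quotient_ge (t : \bar R) (r d e en : R) : 0 < en ->
  ((- e)%:E <= (t - r%:E - d%:E) / en%:E)%E = ((r + (d - e * en))%:E <= t)%E.
Proof.
move=> en0; rewrite inver gt_eqF// lee_pdivlMr// -EFinM.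
case: t => [s||] //=; rewrite ?leey// -!EFinB !lee_fin.
by apply/idP/idP => h; lra.
Qed.

(** At [y = x] the inequality is an equality of values, so the punctured neighbourhood behind the
    lower limit can be replaced by a full one. *)
Lemma frechet_subdiffP phi x v : frechet_subdiff phi x v <->
  exists2 r : R, phi x = r%:E & forall e : R, 0 < e ->
    \forall y \near x, ((r + (dot v (y - x) - e * enorm (y - x)))%:E <= phi y)%E.
Proof.
split=> [[/fineK phix]|[r phix near_phi]].
  rewrite limf_einfE => lim0; exists (fine (phi x)) => // e e0.
  have /lt_le_trans/(_ lim0)/ereal_sup_gt[_ [V xV <-] eV] : ((- e)%:E < 0)%E.
    by rewrite lte_fin oppr_lt0.
  have : nbhs x [set y | y != x -> V y] := xV.
  apply: filterS => y yV; have [->|yx] := eqVneq y x.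
    by rewrite subrr enorm0 dotC dot0l mulr0 subrr addr0 phix.
  rewrite -difference_quotient_ge ?enorm_gt0 ?subr_eq0// phix.
  apply: le_trans (ltW eV) _; apply: ereal_inf_lbound.
  by exists y => //; exact: yV.
split; first by rewrite phix.
rewrite limf_einfE; apply/lee_addgt0Pr => e e0.
rewrite -leeBlDr// sub0e -EFinN.
apply: le_trans (ereal_sup_ubound _); last first.
  exists [set y | y != x /\
    ((r + (dot v (y - x) - e * enorm (y - x)))%:E <= phi y)%E] => //.
  by have := near_phi _ e0; apply: filterS => y py yx.
apply: le_ereal_inf_tmp => _ [y [yx py] <-].
by rewrite phix difference_quotient_ge// enorm_gt0 subr_eq0.
Qed.

(* Fermat's rule with a smooth term, stated as a subtraction so that it also
   yields the smooth sum rule; the smoothness of q enters only through a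
   one-sided quadratic expansion. *)
Lemma frechet_subdiff_subr phi q x v d (c : R) :
  (forall y, q y <= q x + dot d (y - x) + c * dot (y - x) (y - x)) ->
  frechet_subdiff (fun y => ((q y)%:E + phi y)%E) x v ->
  frechet_subdiff phi x (v - d).
Proof.
move=> qx /frechet_subdiffP[r qphix near_phi].
have [s phix] : exists s, phi x = s%:E.
  by move: qphix; case: (phi x) => [s||] //= _; exists s.
apply/frechet_subdiffP; exists s => // e e0.
have rE : r = q x + s by move: qphix; rewrite phix -EFinD => -[].
(* Near [x] the quadratic term costs at most [e / 2 * enorm (y - x)]; the hypothesis on [v], taken
   with tolerance [e / 2], supplies the other half. *)
have near_c : \forall y \near x, `|c| * enorm (y - x) < e / 2.
  have : `|c| * enorm (y - x) @[y --> x] --> `|c| * enorm (x - x).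
    apply: (@cvgM _ _ (nbhs x) _ (fun=> `|c|)); first exact: cvg_cst.
    apply: (@cvg_enorm R n _ (nbhs x) _ (fun y => y - x)).
    exact: (@cvgB R 'rV[R]_n _ (nbhs x) _ id (fun=> x) x x cvg_id (cvg_cst _)).
  rewrite subrr enorm0.
  rewrite mulr0 => /cvgr_lt; apply; lra.
have e20 : 0 < e / 2 by lra.
near=> y; have : ((r + (dot v (y - x) - e / 2 * enorm (y - x)))%:E
    <= (q y)%:E + phi y)%E by near: y; exact: near_phi.
have /ltW/(ler_wpM2r (enorm_ge0 (y - x))) : `|c| * enorm (y - x) < e / 2.
  by near: y.
rewrite -[X in X <= _]mulrA -expr2 sqr_enorm => cd; have dd := dotvv_ge0 (y - x).
have /(ler_wpM2r dd) cc := ler_norm c.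
case: (phi y) => [t||] //; rewrite ?leey//.
rewrite -EFinD !lee_fin rE dotDl dotNl; have := qx y; lra.
Unshelve. all: end_near. Qed.

Lemma frechet_subdiff_local_min phi x (r : R) : phi x = r%:E ->
  (\forall y \near x, (phi x <= phi y)%E) -> frechet_subdiff phi x 0.
Proof.
move=> phix xmin; apply/frechet_subdiffP; exists r => // e e0.
apply: filterS xmin => y; apply: le_trans.
by rewrite phix lee_fin dot0l sub0r gerDl oppr_le0 mulr_ge0 ?enorm_ge0 ?ltW.
Qed.

Lemma chi_in C x : C x -> chi C x = 0%:E.
Proof. by move=> Cx; rewrite /chi mem_set. Qed.

Lemma chi_notin C x : ~ C x -> chi C x = +oo%E.
Proof. by move=> Cx; rewrite /chi memNset. Qed.

Lemma frechet_subdiff_chi_in C x w : frechet_subdiff (chi C) x w -> C x.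
Proof. by case=> + _; apply: contraPP => /chi_notin ->. Qed.

(** Frechet normals form a cone: tolerance [e / a] for [w] becomes tolerance [e] for [a *: w], and
    off [C] the indicator is infinite. *)
Lemma frechet_subdiff_chiZ C x w (a : R) : 0 < a ->
  frechet_subdiff (chi C) x w -> frechet_subdiff (chi C) x (a *: w).
Proof.
move=> a0 fw; have Cx := frechet_subdiff_chi_in _ _ _ fw.
move/frechet_subdiffP: fw => [r]; rewrite chi_in// => -[<-] near_w.
apply/frechet_subdiffP; exists 0; rewrite ?chi_in// => e e0.
have := near_w (e / a) (divr_gt0 e0 a0); apply: filterS => y.
have [Cy|Cy] := pselect (C y); last by rewrite chi_notin// !leey.
rewrite chi_in// !lee_fin !add0r dotZl => h.
have := ler_wpM2l (ltW a0) h; rewrite mulr0 mulrBr mulrA.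
by rewrite (mulrC a (e / a)) divfK// gt_eqF.
Qed.

Lemma subdiff_translation phi a x v :
  subdiff (fun s => phi (a + s)) x v -> subdiff phi (a + x) v.
Proof.
case=> fin [xs [vs [xsx vsv phix fv]]]; split=> //.
exists (fun k => a + xs k), vs; split; [|exact: vsv|exact: phix|].
  exact: (@cvgD R 'rV[R]_n _ \oo _ (fun=> a) xs a x (cvg_cst _)).
move=> k; move/frechet_subdiffP: (fv k) => [r phir near_phi].
apply/frechet_subdiffP; exists r => [//|e e0].
rewrite (near_shift (xs k)); apply: filterS (near_phi e e0) => y /=.
have -> : y + (a + xs k - xs k) = a + y by rewrite addrK addrC.
by rewrite opprD addrACA subrr add0r.
Qed.

End Subdifferentials.

(** * Approximate Fermat rule over a closed set *)

Section SumRule.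
Context {R : realType} {n : nat}.
Implicit Types (g : 'rV[R]_n -> \bar R) (x y z v w : 'rV[R]_n).
Implicit Types (C : set 'rV[R]_n).

(** This feeds the sequences that define limiting subgradients. Those require convergence of
    function values, whence the two-sided bound on [g y]. *)
Lemma fuzzy_sum_rule g C x (r eps : R) :
  lower_semicontinuous g -> (forall y, g y != -oo%E) -> closed C ->
  C x -> g x = r%:E -> (\forall y \near x, C y -> (g x <= g y)%E) -> 0 < eps ->
  exists y z v w, [/\ `|y - x| <= eps /\ `|z - x| <= eps,
    ((r - eps)%:E <= g y <= r%:E)%E, frechet_subdiff g y v,
    frechet_subdiff (chi C) z w & `|v + w| <= eps].
Proof.
move=> lsc_g gNy closedC Cx gx xmin eps0.
have [delta delta0 near_x] : exists2 delta : R, 0 < delta &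
    forall y, `|y - x| <= delta ->
      (C y -> (g x <= g y)%E) /\ ((r - eps)%:E < g y)%E.
  have [|V Vx Vg] := lsc_g x (r - eps); first by rewrite gx lte_fin; lra.
  have xminV : \forall y \near x, (C y -> (g x <= g y)%E) /\ V y.
    exact: filterI.
  move/nbhs_normP: xminV => [e /= e0 eP].
  exists (e / 2) => [|y yx]; first lra.
  by have [|? /Vg] := eP y; first by rewrite /= distrC; lra.
(* The cap [eps / 2] is spent at the very end, where the two subgradients sum to [-2 (y - x)]. *)
pose d := Num.min delta (eps / 2).
(* Minimize g y + |y - x|^2 + (j + 1) |y - z|^2 over y, z near x with z in C:
   the minimizers cluster at (x, x), and once they are interior the optimality
   conditions in y and in z give the two Frechet subgradients. *)
have [d0 dl de] : [/\ 0 < d, d <= delta & d <= eps / 2].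
  by split; rewrite ?lt_min ?ge_min ?lexx ?orbT ?delta0//=; lra.
pose K := [set y : 'rV[R]_n | `|y - x| <= d].
pose J (j : nat) : R := j.+1%:R.
have J0 j : 0 < J j by rewrite ltr0n.
pose q j (p : 'rV[R]_n * 'rV[R]_n) :=
  dot (p.1 - x) (p.1 - x) + J j * dot (p.1 - p.2) (p.1 - p.2).
pose F (j : nat) (p : 'rV[R]_n * 'rV[R]_n) : \bar R := ((q j p)%:E + g p.1)%E.
have cfst (p : 'rV[R]_n * 'rV[R]_n) : p'.1 @[p' --> p] --> p.1 by exact: cvg_fst.
have csnd (p : 'rV[R]_n * 'rV[R]_n) : p'.2 @[p' --> p] --> p.2 by exact: cvg_snd.
have Kx : K x by rewrite /K /= subrr normr0 ltW.
have /choice[p pP] : forall j, exists p, (K `*` (K `&` C)) p /\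
    forall p', (K `*` (K `&` C)) p' -> (F j p <= F j p')%E.
  move=> j; have [|||p Kp pmin] := @compact_lsc_min R _ (K `*` (K `&` C)) (F j).
  - apply: compact_setX; first exact: compact_closed_ball.
    by apply: compact_closedI => //; exact: compact_closed_ball.
  - by exists (x, x).
  - apply: lsc_addr; last exact: lsc_comp.
    move=> p; apply: cvgD; first exact: (cvg_sqdist _ _ _ _ (cfst p) (cvg_cst x)).
    apply: (@cvgM _ _ (nbhs p) _ (fun=> J j)); first exact: cvg_cst.
    exact: (cvg_sqdist _ _ _ _ (cfst p) (csnd p)).
  - by exists p.
(* Comparison with the feasible pair [(x, x)], where the penalized function equals [r]. *)
have pE j : exists2 t : R, g (p j).1 = t%:E & r - eps < t /\
    q j (p j) + t <= r.
  have [[Kp _] /(_ (x, x))] := pP j; rewrite /F /q /= !subrr !dot0l gx.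
  move=> /(_ _)/wrap[//|]; have := (near_x _ (le_trans Kp dl)).2.
  have := gNy (p j).1; case: (g (p j).1) => [t||]// _.
  by rewrite mulr0 addr0 -!EFinD !lee_fin lte_fin add0r; exists t.
have [ps [/= Ky [_ Cz]] [sg sgk psg]] : exists2 ps, (K `*` (K `&` C)) ps &
    exists2 sg : nat -> nat, (forall k, (k <= sg k)%N) & p \o sg @ \oo --> ps.
  apply: compact_extraction; last by move=> j; have [] := pP j.
  apply: compact_setX; first exact: compact_closed_ball.
  by apply: compact_closedI => //; exact: compact_closed_ball.
have py : (p (sg k)).1 @[k --> \oo] --> ps.1.
  exact: (continuous_cvg _ (cfst ps) psg).
have pz : (p (sg k)).2 @[k --> \oo] --> ps.2.
  exact: (continuous_cvg _ (csnd ps) psg).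
(* By [pE] the penalty [J j] times the squared gap stays below [eps], while [J] tends to infinity
   along [sg]. *)
have yz : ps.1 = ps.2.
  apply/eqP; rewrite -subr_eq0 -dotvv_eq0 eq_le dotvv_ge0 andbT leNgt.
  apply/negP => b0; set b := dot _ _ in b0.
  have b20 : b / 2 < b by lra.
  have be0 : 0 < b / 2 / eps by rewrite divr_gt0//; lra.
  near \oo => k.
  have : b / 2 < dot ((p (sg k)).1 - (p (sg k)).2) ((p (sg k)).1 - (p (sg k)).2).
    near: k; exact: (cvgr_gt _ (cvg_sqdist _ _ _ _ py pz)).
  have [t _ [rt]] := pE (sg k); rewrite /q.
  have := dotvv_ge0 ((p (sg k)).1 - x).
  set D := dot _ _; set E := dot _ _ => D0 h bE.
  have : k.+1%:R^-1 < b / 2 / eps.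
    by near: k; exact: (near_infty_natSinv_lt (PosNum be0)).
  have kJ : k.+1%:R <= J (sg k) by rewrite ler_nat ltnS.
  have k0 : 0 < k.+1%:R :> R by rewrite ltr0n.
  rewrite ltr_pdivlMr// mulrC ltr_pdivrMr// => bk.
  have : b / 2 * k.+1%:R <= E * J (sg k) by apply: ler_pM => //; lra.
  by lra.
(* The limit point now lies in [C], so [g] is at least [r] there. Were it at positive squared
   distance [a] from [x], lower semicontinuity would keep [g] above [r - a / 2] while the proximal
   term exceeds [a / 2], contradicting [pE]. *)
have yx : ps.1 = x.
  apply/eqP; rewrite -subr_eq0 -dotvv_eq0 eq_le dotvv_ge0 andbT leNgt.
  apply/negP => a0; set a := dot _ _ in a0.
  have [_ _] := near_x ps.1 (le_trans Ky dl).
  have rg : (r%:E <= g ps.1)%E.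
    by rewrite -gx; apply: (near_x ps.1 (le_trans Ky dl)).1; rewrite yz.
  have [|V Vy Vg] := lsc_g ps.1 (r - a / 2).
    by apply: lt_le_trans rg; rewrite lte_fin; lra.
  have a20 : a / 2 < a by lra.
  near \oo => k.
  have : a / 2 < dot ((p (sg k)).1 - x) ((p (sg k)).1 - x).
    near: k; exact: (cvgr_gt _ (cvg_sqdist _ _ _ _ py (cvg_cst x))).
  have : ((r - a / 2)%:E < g (p (sg k)).1)%E by apply: Vg; near: k; exact: py.
  have [t -> [_]] := pE (sg k); rewrite /q lte_fin.
  by have := mulr_ge0 (ltW (J0 (sg k))) (dotvv_ge0 ((p (sg k)).1 - (p (sg k)).2)); lra.
have zx : ps.2 = x by rewrite -yz.
rewrite yx in py; rewrite zx in pz.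
(* Strict inequalities put both components in the interior of the ball, so minimality becomes local
   minimality in each variable. *)
have [k [ky kz]] : exists k, `|x - (p (sg k)).1| < d /\ `|x - (p (sg k)).2| < d.
  near \oo => k; exists k; split; near: k.
    exact: (cvgr_dist_lt _ _ py _ d0).
  exact: (cvgr_dist_lt _ _ pz _ d0).
move: (sg k) ky kz => j yd zd.
have [[Kyj [Kzj Czj]] pmin] := pP j; have [t gt [rt qt]] := pE j.
set y := (p j).1 in yd Kyj gt *; set z := (p j).2 in zd Kzj Czj *.
have pjE : p j = (y, z) by rewrite /y /z; case: (p j).
have Kint (y0 : 'rV[R]_n) : `|x - y0| < d -> \forall y' \near y0, K y'.
  move=> y0d; apply/nbhs_normP; exists (d - `|x - y0|) => /=; first lra.
  move=> y' /= yy'; rewrite /K /=; have := ler_normD (y' - y0) (y0 - x).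
  by rewrite addrA subrK (distrC y0) (distrC y' y0); lra.
(* Partial gradients of [q j] at [(y, z)]; the large terms in [J j] cancel in [dy + dz], leaving
   [2 *: (y - x)]. *)
pose dy := 2 *: (y - x) + (2 * J j) *: (y - z).
pose dz := (2 * J j) *: (z - y).
have Fy : frechet_subdiff g y (0 - dy).
  apply: (@frechet_subdiff_subr R n g (fun y' => q j (y', z)) y 0 dy (1 + J j)).
    move=> y'; rewrite /q /=.
    rewrite -[y' - x](subrKA y) -[y' - z](subrKA y) ![y' - y + _]addrC.
    rewrite (dot_sqrD (y - x)) (dot_sqrD (y - z)) /dy (dotDl (2 *: _)) !dotZl; lra.
  apply: (@frechet_subdiff_local_min _ _ _ _ (q j (y, z) + t)); first by rewrite gt.
  apply: filterS (Kint _ yd) => y' Ky'; rewrite -pjE; exact: pmin.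
have Fz : frechet_subdiff (chi C) z (0 - dz).
  apply: (@frechet_subdiff_subr R n (chi C)
    (fun z' => J j * dot (z' - y) (z' - y)) z 0 dz (J j)).
    move=> z'; rewrite -[z' - y](subrKA z) [z' - z + _]addrC.
    by rewrite (dot_sqrD (z - y)) /dz dotZl; lra.
  apply: (@frechet_subdiff_local_min _ _ _ _ (J j * dot (z - y) (z - y))).
    by rewrite chi_in// adde0.
  apply: filterS (Kint _ zd) => z' Kz'; have [Cz'|Cz'] := pselect (C z').
    rewrite !chi_in// !adde0 lee_fin.
    have := pmin (y, z') (conj Kyj (conj Kz' Cz')).
    rewrite /F pjE /= gt -!EFinD lee_fin /q /=.
    by rewrite -(opprB z y) -(opprB z' y) !dotNl !dotNr !opprK; lra.
  by rewrite (chi_notin _ _ Cz') addey ?leey.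
exists y, z, (0 - dy), (0 - dz); split=> //.
- by split; apply: le_trans (_ : d <= _); rewrite //; lra.
- rewrite gt !lee_fin; apply/andP; split; first exact: ltW.
  have := mulr_ge0 (ltW (J0 j)) (dotvv_ge0 (y - z)).
  by have := dotvv_ge0 (y - x); move: qt; rewrite /q pjE /=; lra.
rewrite /dy /dz -(opprB y z) scalerN !sub0r opprD opprK subrK normrN normrZ.
by rewrite ger0_norm//; move: Kyj; rewrite /K /=; lra.
Unshelve. all: end_near. Qed.

End SumRule.

(** * Limiting Fermat rule and subtraction of a smooth term *)

Section LimitingRules.
Context {R : realType} {n : nat}.
Implicit Types (g phi : 'rV[R]_n -> \bar R) (x y z v w : 'rV[R]_n).
Implicit Types (C : set 'rV[R]_n).

Lemma cvg_dist_le_natSinv (a : nat -> 'rV[R]_n) x :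
  (forall k, `|a k - x| <= k.+1%:R^-1) -> a @ \oo --> x.
Proof.
move=> ax; apply/cvgrPdist_lt => e e0; near=> k.
rewrite distrC; apply: le_lt_trans (ax k) _.
by near: k; exact: (near_infty_natSinv_lt (PosNum e0)).
Unshelve. all: end_near. Qed.

(** The fuzzy rule with tolerance [1 / (k + 1)] gives subgradients and Frechet normals whose sums
    tend to [0]; the qualification provides the compactness needed to pass to the limit. *)
Lemma fermat_rule_qualified g C x (r : R) :
  lower_semicontinuous g -> (forall y, g y != -oo%E) -> closed C ->
  C x -> g x = r%:E -> (\forall y \near x, C y -> (g x <= g y)%E) ->
  constraint_qualification g C x ->
  exists v w, [/\ subdiff g x v, normal_cone C x w & v + w = 0].
Proof.
move=> lsc_g gNy closedC Cx gx xmin CQ.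
have /choice[t tP] : forall k : nat,
    exists t : ('rV[R]_n * 'rV[R]_n) * ('rV[R]_n * 'rV[R]_n),
    [/\ `|t.1.1 - x| <= k.+1%:R^-1 /\ `|t.1.2 - x| <= k.+1%:R^-1,
      ((r - k.+1%:R^-1)%:E <= g t.1.1 <= r%:E)%E, frechet_subdiff g t.1.1 t.2.1,
      frechet_subdiff (chi C) t.1.2 t.2.2 & `|t.2.1 + t.2.2| <= k.+1%:R^-1].
  move=> k; have k0 : 0 < k.+1%:R^-1 :> R by rewrite invr_gt0.
  have [y [z [v [w h]]]] :=
    fuzzy_sum_rule g C x r _ lsc_g gNy closedC Cx gx xmin k0.
  by exists ((y, z), (v, w)).
pose y k := (t k).1.1; pose z k := (t k).1.2.
pose v k := (t k).2.1; pose w k := (t k).2.2.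
have yx : y @ \oo --> x by apply: cvg_dist_le_natSinv => k; have [[]] := tP k.
have zx : z @ \oo --> x by apply: cvg_dist_le_natSinv => k; have [[]] := tP k.
have vw0 : v k + w k @[k --> \oo] --> (0 : 'rV[R]_n).
  by apply: cvg_dist_le_natSinv => k; rewrite subr0; have [] := tP k.
have gyx : g (y k) @[k --> \oo] --> g x.
  rewrite gx; apply: (@squeeze_cvge _ _ _ _ (fun k => (r - k.+1%:R^-1)%:E) _ (fun=> r%:E)).
  - by apply: nearW => k; have [] := tP k.
  - apply: cvg_EFin; first exact: nearW.
    rewrite -[X in _ --> X]subr0; apply: cvgB; first exact: cvg_cst.
    exact: cvg_harmonic.
  - exact: cvg_cst.
have gfin : g x \is a fin_num by rewrite gx.
have chifin : chi C x \is a fin_num by rewrite chi_in.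
have fv k : frechet_subdiff g (y k) (v k) by case: (tP k) => _ _ + _ _; exact.
have fw k : frechet_subdiff (chi C) (z k) (w k) by case: (tP k) => _ _ _ + _; exact.
(* A point carrying a Frechet normal lies in [C], so the indicator is [0] along the whole
   sequence. *)
have chiz (sg : nat -> nat) : chi C (z (sg k)) @[k --> \oo] --> chi C x.
  have -> : (fun k => chi C (z (sg k))) = (fun=> chi C x); last exact: cvg_cst.
  apply/funext => k; rewrite [RHS]chi_in// chi_in//.
  exact: frechet_subdiff_chi_in (fw _).
(* If the normals w stay bounded along a subsequence, their limit is the
   required normal; otherwise the normalized ones violate the qualification. *)
have [[M wM]|winfty] := pselect (exists M, forall k : nat,
    exists j, (k <= j)%N /\ `|w j| <= M).
  have [s1 s1P] := choice wM.
  have [w0 _ [s2 s2P ws]] : exists2 w0 : 'rV[R]_n, [set w0 : 'rV[R]_n | `|w0 - 0| <= M] w0 &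
      exists2 sg : nat -> nat, (forall k, (k <= sg k)%N) & (w \o s1) \o sg @ \oo --> w0.
    apply: compact_extraction; first exact: compact_closed_ball.
    by move=> k /=; rewrite subr0; have [] := s1P k.
  pose sg := s1 \o s2.
  have sgoo : sg @ \oo --> \oo.
    by apply: cvg_ge_id => k; apply: leq_trans (s2P k) _; have [] := s1P (s2 k).
  (* Since [v + w] tends to [0], convergence of [w] to [w0] forces that of [v] to [- w0]. *)
  exists (- w0), w0; split; last exact: addNr.
    split=> //; exists (y \o sg), (v \o sg); split; last by move=> k; exact: fv.
    + exact: (cvg_comp _ _ sgoo yx).
    + have -> : v \o sg = fun k => (v (sg k) + w (sg k)) - w (sg k).
        by apply/funext => k; rewrite addrK.
      rewrite -[- w0]add0r; apply: (@cvgB R 'rV[R]_n); last exact: ws.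
      exact: (cvg_comp _ _ sgoo vw0).
    + exact: (cvg_comp _ _ sgoo gyx).
  split=> //; exists (z \o sg), (w \o sg); split; last by move=> k; exact: fw.
  + exact: (cvg_comp _ _ sgoo zx).
  + exact: ws.
  + exact: chiz.
have wM M : exists k0, forall j, (k0 <= j)%N -> M < `|w j|.
  apply: contrapT => h; apply: winfty; exists M => k.
  apply: contrapT => h'; apply: h; exists k => j kj.
  by rewrite ltNge; apply/negP => wj; apply: h'; exists j.
(* From index [k0] on the normals are nonzero and can be normalized. *)
have [k0 k0P] := wM 0.
pose u j := `|w (j + k0)%N|^-1 *: w (j + k0)%N.
have u1 j : `|u j| = 1.
  have wj := k0P _ (leq_addl j k0).
  by rewrite normrZ normfV normr_id mulVf// gt_eqF.
have [u0 _ [s2 s2P us]] : exists2 u0 : 'rV[R]_n, [set u0 : 'rV[R]_n | `|u0 - 0| <= 1] u0 &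
    exists2 sg : nat -> nat, (forall k, (k <= sg k)%N) & u \o sg @ \oo --> u0.
  apply: compact_extraction; first exact: compact_closed_ball.
  by move=> k /=; rewrite subr0 u1.
have nu0 : `|u0| = 1.
  have h : `|(u \o s2) k| @[k --> \oo] --> `|u0| by exact: cvg_norm.
  rewrite -(cvg_lim _ h)//; under eq_fun do rewrite /= u1.
  by rewrite lim_cst.
pose sg k := (s2 k + k0)%N.
have sgk k : (k <= sg k)%N by rewrite (leq_trans (s2P k))// leq_addr.
have sgoo : sg @ \oo --> \oo by exact: cvg_ge_id.
(* One scaling serves twice: [lam k *: w (sg k)] are still Frechet normals and tend to [u0], while
   [lam k *: v (sg k)] tends to [- u0], a horizon subgradient. *)
pose lam k := `|w (sg k)|^-1.
have lam0 k : 0 < lam k by rewrite invr_gt0 k0P// leq_addl.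
have lamcvg : lam @ \oo --> (0 : R).
  apply/cvgrPdist_lt => e e0; have [k1 k1P] := wM e^-1.
  exists k1 => // k /= k1k; rewrite sub0r normrN gtr0_norm// /lam.
  have wk := k1P _ (leq_trans k1k (sgk k)).
  have ei : 0 < e^-1 by rewrite invr_gt0.
  by rewrite -[e]invrK ltf_pV2// posrE (lt_trans ei wk).
have NCu : normal_cone C x u0.
  split=> //; exists (z \o sg), (fun k => lam k *: w (sg k)); split.
  - exact: (cvg_comp _ _ sgoo zx).
  - exact: us.
  - exact: chiz.
  - by move=> k; apply: frechet_subdiff_chiZ => //; exact: fw.
have Hu : horizon_subdiff g x (- u0).
  split=> //; exists (y \o sg), (v \o sg), lam; split.
  - exact: (cvg_comp _ _ sgoo yx).
  - by split.
  - exact: (cvg_comp _ _ sgoo gyx).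
  - by move=> k; exact: fv.
  - have -> : (fun k => lam k *: (v \o sg) k) =
        (fun k => lam k *: (v (sg k) + w (sg k)) - lam k *: w (sg k)).
      by apply/funext => k; rewrite scalerDr addrK.
    rewrite -[- u0]add0r -[X in X - u0](scaler0 _ (0 : R)).
    apply: (@cvgB R 'rV[R]_n); last exact: us.
    apply: (@cvgZ R 'rV[R]_n); first exact: lamcvg.
    exact: (cvg_comp _ _ sgoo vw0).
have : (horizon_subdiff g x `&` [set - v | v in normal_cone C x]) (- u0).
  by split=> //; exists u0.
rewrite CQ /= => /eqP; rewrite oppr_eq0 -normr_eq0 nu0.
by rewrite (negbTE (oner_neq0 _)).
Qed.

(** Each approximating subgradient is corrected by [d] at its own base point. The values of [phi]
    converge as differences of those of the sum and of the real-valued [q]. *)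
Lemma subdiff_subr phi (q : 'rV[R]_n -> R) (d : 'rV[R]_n -> 'rV[R]_n) (c : R) x v :
  (forall y y', q y' <= q y + dot (d y) (y' - y) + c * dot (y' - y) (y' - y)) ->
  {for x, continuous q} -> {for x, continuous d} ->
  subdiff (fun y => (q y)%:E + phi y)%E x v -> subdiff phi x (v - d x).
Proof.
move=> qd qx dx [fin [xs [vs [xsx vsv qphix fv]]]].
have phifin : phi x \is a fin_num by move: fin; case: (phi x).
split=> //; exists xs, (fun k => vs k - d (xs k)); split.
- exact: xsx.
- apply: (@cvgB R 'rV[R]_n) => //; exact: (cvg_comp _ _ xsx dx).
- have -> : (fun k => phi (xs k)) =
      (fun k => ((q (xs k))%:E + phi (xs k)) - (q (xs k))%:E)%E.
    by apply/funext => k; rewrite addeAC subee// add0e.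
  have -> : phi x = ((q x)%:E + phi x - (q x)%:E)%E.
    by rewrite addeAC subee// add0e.
  apply: cvgeB => //; first by rewrite fin_num_adde_defl.
  by apply: cvg_EFin; [exact: nearW|exact: (cvg_comp _ _ xsx qx)].
- by move=> k; apply: (@frechet_subdiff_subr R n phi q _ _ _ c); [exact: qd|exact: fv].
Qed.

End LimitingRules.

(** * Limits along an infinite index set *)

Lemma within_eventually_proper (N : set nat) :
  infinite_set N -> ProperFilter (within N \oo).
Proof.
move=> infN; split; last exact: within_filter.
case=> K _ KN; apply: infN; apply: (sub_finite_set _ (finite_II K)).
by move=> k Nk /=; rewrite ltnNge; apply/negP => /KN; exact.
Qed.

Lemma cvg_within_subset {T : nbhsType} (N1 N : set nat) (a : nat -> T) (t : T) :
  N1 `<=` N -> a @ within N \oo --> t -> a @ within N1 \oo --> t.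
Proof.
move=> NN aN P tP; have : \forall k \near \oo, N k -> P (a k) by exact: aN.
by apply: filterS => k aP /NN.
Qed.

(** * Radii and Cauchy steps along a run *)

Section RunFacts.
Context {R : realType} {n : nat}.

Lemma spectral_norm_ge0 (B : 'M[R]_n) : 0 <= spectral_norm B.
Proof.
rewrite /spectral_norm; set E := [set _ | _ in _].
(* [sup] is [0] by default on a set without supremum; otherwise it dominates the norm of the image
   of [0]. *)
have [supE|/sup_out -> //] := pselect (has_sup E).
apply: (@le_trans _ _ (enorm ((0 : 'rV[R]_n) *m B^T))); first exact: enorm_ge0.
apply: ub_le_sup; first by case: supE.
by exists 0 => //=; rewrite enorm0.
Qed.

Lemma closed_box (l u : 'rV[\bar R]_n) : closed (box l u).
Proof.
have -> : box l u = \bigcap_(i in setT)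
    ((fun x : 'rV[R]_n => (x 0 i)%:E) @^-1`
      ([set a | (l 0%R i <= a)%E] `&` [set a | (a <= u 0%R i)%E])).
  by apply/seteqP; split=> x /= h i; [move=> _ /=; exact/andP|exact/andP/(h i)].
apply: closed_bigI => i _; apply: preimage_closed.
  move=> x _; apply: (@cvg_EFin R _ (nbhs x) _); first exact: nearW.
  exact: coord_continuous.
by apply: closedI; [exact: closed_ereal_le_ereal|exact: closed_ereal_ge_ereal].
Qed.

Context (f : 'rV[R]_n -> R) (h : 'rV[R]_n -> \bar R) (l u : 'rV[\bar R]_n)
  (psi : 'rV[R]_n -> 'rV[R]_n -> \bar R) (c : tr_constants R)
  (it : tr_sequences R n) (run : tr_run f h l u psi c it).

Lemma iter_Delta_gt0 k : 0 < iter_Delta it k.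
Proof.
elim: k => [|k Dk].
  by rewrite (run_Delta0 run); have /andP[] := Delta_bounds c.
have [D + ->] := run_Delta run k.
have /andP[D0 Dmax] := Delta_bounds c.
rewrite /radius_range lt_min (lt_trans D0 Dmax) andbT.
have [/andP[g30 g31] /andP[g12 _] /andP[g3 _]] := gamma_bounds c.
have g1 : 0 < gamma1 c by exact: lt_le_trans g31.
have g2 : 0 < gamma2 c by exact: lt_le_trans g12.
have g3' : 0 < gamma3 c by exact: lt_trans g3.
by case: ifP => _; last case: ifP => _; move=> /andP[+ _]; apply: lt_le_trans; rewrite mulr_gt0.
Qed.

(** Read backwards, the radius is at least [nu / alpha], so step lengths with a positive limit keep
    the trust region from collapsing. The denominator of [nu_max] is at least [1]. *)
Lemma iter_nu_le k : iter_nu it k <= alpha c * iter_Delta it k.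
Proof.
have /andP[_] := run_nu run k; move/le_trans; apply.
have aD : 0 <= alpha c * iter_Delta it k.
  by rewrite ltW// mulr_gt0 ?alpha_gt0 ?iter_Delta_gt0.
have B0 := spectral_norm_ge0 (iter_B it k).
have den : 1 <= 1 + spectral_norm (iter_B it k) * (1 + alpha c * iter_Delta it k).
  by rewrite lerDl mulr_ge0// addr_ge0.
by rewrite /nu_max ler_pdivrMr ?(lt_le_trans _ den)// ler_peMr.
Qed.

Lemma cauchy_step_le k (y : 'rV[R]_n) : box l u y ->
  enorm (y - iter_x it k) <= iter_Delta it k ->
  (m_cp f (psi (iter_x it k)) (iter_x it k) (iter_nu it k) (iter_s1 it k) <=
   m_cp f (psi (iter_x it k)) (iter_x it k) (iter_nu it k) (y - iter_x it k))%E.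
Proof.
move=> boxy ny; have /(_ (y - iter_x it k)) := run_s1 run k.
rewrite [_ + (y - _)]subrKC [X in (_ <= _ + X)%E]chi_in; last by split.
rewrite adde0; apply: le_trans; rewrite leeDl//.
by rewrite /chi; case: ifP => _; rewrite ?leey.
Qed.

End RunFacts.

(** * Limits and subgradients of the Cauchy model *)

Section CauchyModel.
Context {R : realType} {n : nat}.
Implicit Types (f : 'rV[R]_n -> R) (ps : 'rV[R]_n -> \bar R) (x s : 'rV[R]_n).

Lemma cvg_m_cp {T : Type} {F : set_system T} {FF : Filter F} f
    (ps : T -> 'rV[R]_n -> \bar R) (xs ss : T -> 'rV[R]_n) (nus : T -> R)
    psbar x s (nu : R) :
  {for x, continuous f} -> {for x, continuous (grad f)} -> 0 < nu ->
  xs @ F --> x -> ss @ F --> s -> nus @ F --> nu ->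
  ps t (ss t) @[t --> F] --> psbar s ->
  m_cp f (ps t) (xs t) (nus t) (ss t) @[t --> F] --> m_cp f psbar x nu s.
Proof.
move=> fx gx nu0 xsx sss nusnu pss; apply: cvgeD => //.
apply: cvg_EFin; first exact: nearW.
apply: cvgD; first apply: cvgD.
- exact: (cvg_comp _ _ xsx fx).
- by apply: cvg_dot => //; exact: (cvg_comp _ _ xsx gx).
- apply: cvgM; first apply: cvgM; first exact: cvg_cst.
    by apply: cvgV => //; rewrite gt_eqF.
  under eq_fun do rewrite sqr_enorm; rewrite sqr_enorm; exact: cvg_dot.
Qed.

Lemma continuous_cp_quadratic f x (nu : R) :
  continuous (fun s => phi_cp f x s + 2^-1 * nu^-1 * enorm s ^+ 2).
Proof.
have cvg_q (F : set_system 'rV[R]_n) (FF : Filter F) s : F --> s ->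
    phi_cp f x t + 2^-1 * nu^-1 * enorm t ^+ 2 @[t --> F]
    --> phi_cp f x s + 2^-1 * nu^-1 * enorm s ^+ 2.
  move=> Fs; apply: cvgD; first (apply: cvgD; first exact: cvg_cst).
    by apply: (@cvg_dot R n _ F _ (fun=> grad f x)); [exact: cvg_cst|exact: Fs].
  apply: cvgM; first exact: cvg_cst.
  under eq_fun do rewrite sqr_enorm; rewrite sqr_enorm.
  exact: (@cvg_dot R n _ F _ id id).
by move=> s; exact: (cvg_q (nbhs s) _ s cvg_id).
Qed.

(** The proximal term has zero gradient at [0], so only [grad f x] has to be subtracted. *)
Lemma subdiff_m_cp f ps x (nu : R) v :
  subdiff (m_cp f ps x nu) 0 v -> subdiff ps 0 (v - grad f x).
Proof.
pose d s := grad f x + nu^-1 *: s.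
have -> : grad f x = d 0 by rewrite /d scaler0 addr0.
apply: (@subdiff_subr R n ps (fun s => phi_cp f x s + 2^-1 * nu^-1 * enorm s ^+ 2)
  d (2^-1 * nu^-1)).
- move=> s s'; rewrite /phi_cp !sqr_enorm /d -[in X in X <= _](subrK s s') [s' - s + s]addrC.
  rewrite (dot_sqrD s) (dotDl (grad f x)) dotZl (dotDr (grad f x) s); lra.
- exact: continuous_cp_quadratic.
- apply: (@cvgD R 'rV[R]_n _ (nbhs (0 : 'rV[R]_n)) _ (fun=> grad f x)).
    exact: cvg_cst.
  apply: (@cvgZ R 'rV[R]_n _ (nbhs (0 : 'rV[R]_n)) _ (fun=> nu^-1) id).
    exact: cvg_cst.
  exact: cvg_id.
Qed.

Lemma lsc_m_cp f ps x (nu : R) :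
  lower_semicontinuous ps -> lower_semicontinuous (m_cp f ps x nu).
Proof.
by move=> lsc; apply: lsc_addr => //; exact: continuous_cp_quadratic.
Qed.

End CauchyModel.

Theorem theorem3p9 (R : realType) (n : nat)
  (f : 'rV[R]_n -> R) (h : 'rV[R]_n -> \bar R)
  (l u : 'rV[\bar R]_n) (psi : 'rV[R]_n -> 'rV[R]_n -> \bar R)
  (c : tr_constants R) (it : tr_sequences R n)
  (* problem (P) and models *)
  (l_neq_pinfty : forall i, l 0 i != +oo%E)
  (u_neq_ninfty : forall i, u 0 i != -oo%E)
  (l_le_u : forall i, (l 0%R i <= u 0%R i)%E)
  (f_C1 : exists O : set 'rV[R]_n,
    [/\ open O, box l u `<=` O & continuously_differentiable_on f O])
  (h_proper : proper_function h) (h_lsc : lower_semicontinuous h)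
  (psi_model : model_assumption h psi)
  (* run of the algorithm *)
  (run : tr_run f h l u psi c it)
  (nu_eq : forall k, iter_nu it k = nu_max c it k)
  (* (i) *)
  (kappa_mdc : R) (kappa_mdc_bounds : 0 < kappa_mdc < 1)
  (model_decrease : forall k,
    (kappa_mdc%:E * xi_cp f h psi it k
       <= m_k f psi it k 0%R - m_k f psi it k (iter_s it k))%E)
  (* (ii) *)
  (kappa_ubd : R) (kappa_ubd_gt0 : 0 < kappa_ubd)
  (model_error : forall k,
    (`|objective f h (iter_x it k + iter_s it k)%R
         - m_k f psi it k (iter_s it k)|
       <= (kappa_ubd * (1 + spectral_norm (iter_B it k))
             * enorm (iter_s it k) ^+ 2)%:E)%E)
  (* (iii) *)
  (mu p : R) (mu_gt0 : 0 < mu) (p_bounds : 0 < p < 1)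
  (hessian_growth : forall k,
    \big[Num.max/0]_(j < k.+1) spectral_norm (iter_B it j)
      <= mu * (1 + (sigma f h psi c it k)%:R `^ p))
  (* (iv) *)
  (infinitely_successful : infinite_set [set k | successful f h psi c it k])
  (many_successful : \forall eps \near 0^'+,
    ((mu + 1)%:E <= mu%:E * counting (S_eps f h psi c it eps) `^ p)%E)
  (* (v) *)
  (bounded_below : exists M : R, forall k,
    (M%:E <= objective f h (iter_x it k))%E)
  (* subsequences *)
  (N : set nat) (N_infinite : infinite_set N)
  (criticality_cvg : criticality f h psi it @ within N \oo --> 0)
  (scaled_s1_cvg :
    (iter_nu it k)^-1 *: iter_s1 it k @[k --> within N \oo] --> (0 : 'rV[R]_n))
  (s1_cvg : iter_s1 it @ within N \oo --> (0 : 'rV[R]_n))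
  (s_cvg : iter_s it @ within N \oo --> (0 : 'rV[R]_n))
  (N1 : set nat) (N1_sub : N1 `<=` N) (N1_infinite : infinite_set N1)
  (nubar : R) (nubar_gt0 : 0 < nubar)
  (nu_cvg : iter_nu it @ within N1 \oo --> nubar)
  (xbar : 'rV[R]_n) (xbar_feasible : box l u xbar)
  (x_cvg : iter_x it @ within N1 \oo --> xbar)
  (* limit model *)
  (psibar : 'rV[R]_n -> \bar R)
  (psi_cvg : continuous_cvg_along N1 (fun k => psi (iter_x it k)) psibar)
  (psibar_proper : proper_function psibar) (psibar_lsc : lower_semicontinuous psibar)
  (psibar0 : psibar 0 = h xbar)
  (psibar_subdiff : subdiff psibar 0 `<=` subdiff h xbar)
  (* constraint qualifications *)
  (CQ_model : constraint_qualification (m_cp f psibar xbar nubar)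
    [set s | box l u (xbar + s)] 0)
  (CQ_P : constraint_qualification (objective f h) (box l u) xbar)
  (inf_finite :
    (-oo < ereal_inf (range (fun s =>
       m_cp f psibar xbar nubar s + chi (box l u) (xbar + s)%R)) < +oo)%E) :
  stationary f h l u xbar.

Proof.
have [U [_ boxU f_diff]] := f_C1.
have [fdiff gradcont] := f_diff _ (boxU _ xbar_feasible).
have fcont : {for xbar, continuous f} by exact: differentiable_continuous.
have PF := within_eventually_proper N1 N1_infinite.
have a0 := alpha_gt0 c.
pose g := m_cp f psibar xbar nubar.
pose C : set 'rV[R]_n := [set s | box l u (xbar + s)].
have psibarNy := psibar_proper.1.
(* The qualification is an equality of sets, so [0] is a horizon subgradient of [g] at [0], and such
   membership includes finiteness of [g 0]. *)
have g0fin : g 0 \is a fin_num.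
  have : (horizon_subdiff g 0 `&` [set - v | v in normal_cone C 0]) 0.
    by rewrite CQ_model.
  by case=> -[].
have gmin : \forall s \near (0 : 'rV[R]_n), C s -> (g 0%R <= g s)%E.
  (* Eventually [nu] exceeds [nubar / 2] along [N1], so every radius there is at least
     [nubar / 2 / alpha c]. *)
  have d0 : 0 < nubar / 2 / alpha c by rewrite !divr_gt0.
  have : enorm s @[s --> (0 : 'rV[R]_n)] --> enorm (0 : 'rV[R]_n).
    exact: (@cvg_enorm R n _ (nbhs (0 : 'rV[R]_n)) _ id _ cvg_id).
  rewrite enorm0 => /cvgr_lt/(_ _ d0); apply: filterS => s sd Cs.
  (* This shifted step leads from the iterate exactly to [xbar + s], hence stays in the box, and
     tends to [s]. *)
  have ycvg : xbar + s - iter_x it k @[k --> within N1 \oo] --> s.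
    rewrite -[X in _ --> X](addKr xbar s) [- xbar + _]addrC.
    by apply: (@cvgB R 'rV[R]_n) => //; exact: cvg_cst.
  have s1N1 := cvg_within_subset _ _ _ _ N1_sub s1_cvg.
  (* Continuous convergence of the models gives both limits: along the Cauchy steps, which tend to
     [0], and along the shifted steps. *)
  apply: (@lee_cvg_to _ (within N1 \oo) PF R
    (fun k => m_cp f (psi (iter_x it k)) (iter_x it k) (iter_nu it k) (iter_s1 it k))
    (fun k => m_cp f (psi (iter_x it k)) (iter_x it k) (iter_nu it k)
                (xbar + s - iter_x it k))).
  - exact: cvg_m_cp _ _ _ _ _ _ _ _ _ _ _ (psi_cvg _ _ s1N1).
  - exact: cvg_m_cp _ _ _ _ _ _ _ _ _ _ _ (psi_cvg _ _ ycvg).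
  near=> k; apply: (cauchy_step_le _ _ _ _ _ _ _ run) => //.
  apply: (@le_trans _ _ (nubar / 2 / alpha c)).
    by apply/ltW; near: k; exact: (cvgr_lt _ (cvg_enorm _ _ ycvg)).
  rewrite ler_pdivrMr// [X in _ <= X]mulrC; apply: le_trans (iter_nu_le _ _ _ _ _ _ _ run k).
  apply/ltW; near: k; apply: (cvgr_gt _ nu_cvg); lra.
have closedC : closed C.
  apply: (@preimage_closed _ _ (fun s => xbar + s)); last exact: closed_box.
  move=> s _.
  exact: (@cvgD R 'rV[R]_n _ (nbhs s) _ (fun=> xbar) id _ _ (cvg_cst _) cvg_id).
have C0 : C 0 by rewrite /C /= addr0.
have gNy s : g s != -oo%E by rewrite /g /m_cp; case: (psibar s) (psibarNy s).
have [v [w [gv Cw vw]]] := fermat_rule_qualified g C 0 (fine (g 0))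
  (lsc_m_cp _ _ _ _ psibar_lsc) gNy closedC C0 (esym (fineK g0fin)) gmin CQ_model.
exists (v - grad f xbar), w; split.
- exact/psibar_subdiff/subdiff_m_cp/gv.
(* The indicator of [C] is that of the box translated by [xbar], so normals to [C] at [0] are
   normals to the box at [xbar]. *)
- rewrite -[xbar]addr0; apply: subdiff_translation.
  have -> : (fun s => chi (box l u) (xbar + s)) = chi C; last exact: Cw.
  apply/funext => s; have [Cs|Cs] := pselect (C s).
    by rewrite (chi_in C s Cs) chi_in.
  by rewrite (chi_notin C s Cs) chi_notin.
- by rewrite [grad f xbar + _]addrC subrK.
Unshelve. all: end_near. Qed.
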